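(* Let $n,k\ge 2$ be integers and let $a$ be an integer with $0\le a<k$. Then $$M_{nk+a}^{(k)}M_{nk+a-2}^{(k)}-\left(M_{nk+a-1}^{(k)}\right)^2=\begin{cases}-2^{n-1}M_n^{2k-2}, & a=1,\\ 0, & a\ne 1,\end{cases}$$ where $M_n^{2k-2}$ denotes the $(2k-2)$-th power of $M_n$.
   Context: The Mersenne numbers $(M_n)_{n\ge 0}$ are defined by $M_0=0$, $M_1=1$, $M_{n+2}=3M_{n+1}-2M_n$ for $n\ge 0$. Let $\lambda_1=2$ and $\lambda_2=1$ be the roots of $\lambda^2-3\lambda+2=0$. For integers $n\ge 0$, $k\ge 1$, write uniquely $n=sk+r$ with integers $s\ge 0$ and $0\le r<k$; the generalized $k$-Mersenne number is $M_n^{(k)}=(\lambda_1^{s}-\lambda_2^{s})^{k-r}(\lambda_1^{s+1}-\lambda_2^{s+1})^{r}$. *)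

(* Defs.v *)
From mathcomp Require Import all_boot all_order all_algebra.

Set Implicit Arguments.
Unset Strict Implicit.
Unset Printing Implicit Defensive.

Import Order.TTheory GRing.Theory Num.Theory.
Local Open Scope ring_scope.

Fixpoint mersenne (n : nat) : int :=
  match n with
  | 0 => 0
  | 1 => 1
  | (m.+1 as p).+1 => 3 * mersenne p - 2 * mersenne m
  end.

(* The roots of x ^+ 2 - 3 * x + 2. *)
Definition lambda1 : int := 2.
Definition lambda2 : int := 1.

(* For 0 < k, s = n %/ k and r = n %% k are the unique naturals such that
   n = s * k + r and r < k; the value at k = 0 is meaningless. *)
Definition gen_mersenne (k n : nat) : int :=
  let s := (n %/ k)%N in
  let r := (n %% k)%N in
  (lambda1 ^+ s - lambda2 ^+ s) ^+ (k - r)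
  * (lambda1 ^+ s.+1 - lambda2 ^+ s.+1) ^+ r.

(* Main.v *)
Require Import Defs.
From mathcomp Require Import all_boot all_order all_algebra.
From mathcomp Require Import zify ring.

(** On the block of indices [s * k + r] with [r <= k], the generalized number
    is [M_s ^ (k - r) * M_(s + 1) ^ r] ([gen_mersenne_block]), a geometric
    progression in [r], of ratio [M_(s + 1) / M_s] when [0 < s]. The last term
    [r = k] of a block is the first term of the next one, so consecutive blocks
    share their endpoints. Three consecutive indices lying in one block form a
    geometric progression, and the Cassini expression vanishes on them
    ([gen_mersenne_geometric]). With middle index [n * k + a - 1] this covers
    every [a] except [a = 1], where the middle index is itself an endpoint
    and the ratio jumps from [M_n / M_(n - 1)] to [M_(n + 1) / M_n]; what
    remains is [M_n ^ (2 * k - 2)] times the Cassini expression of the ordinary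
    Mersenne numbers ([mersenne_cassini]). *)

Import Order.TTheory GRing.Theory Num.Theory.
Local Open Scope ring_scope.

Lemma mersenneE (n : nat) : mersenne n = 2 ^+ n - 1.
Proof.
(* The recurrence has order two, so two consecutive values are carried along. *)
suff [] : mersenne n = 2 ^+ n - 1 /\ mersenne n.+1 = 2 ^+ n.+1 - 1 by [].
elim: n => [|n [IH0 IH1]]; first by [].
split=> //; rewrite -[LHS]/(3 * mersenne n.+1 - 2 * mersenne n) IH0 IH1.
by rewrite !exprS; ring.
Qed.

Lemma mersenne_cassini (m : nat) :
  mersenne m.+2 * mersenne m - mersenne m.+1 ^+ 2 = - 2 ^+ m.
Proof. by rewrite !mersenneE !exprS; ring. Qed.

(** Euclidean division makes this the definition for [r < k]. The formula
    persists at [r = k], where it reads [M_(s + 1) ^ k], the initial term of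
    block [s + 1]; this overlap lets a single formula reach across a block
    boundary. *)
Lemma gen_mersenne_block (k s r : nat) : (0 < k)%N -> (r <= k)%N ->
  gen_mersenne k (s * k + r) = mersenne s ^+ (k - r) * mersenne s.+1 ^+ r.
Proof.
move=> k_gt0; rewrite leq_eqVlt => /predU1P[-> | r_lt_k];
  rewrite /gen_mersenne /lambda1 /lambda2 !expr1n -!mersenneE.
- by rewrite -mulSnr mulnK // modnMl subn0 subnn !expr0 mulr1 mul1r.
- by rewrite divnMDl // divn_small // addn0 modnMDl modn_small.
Qed.

Lemma gen_mersenne_geometric (k s r : nat) : (r.+2 <= k)%N ->
  gen_mersenne k (s * k + r.+2) * gen_mersenne k (s * k + r)
  = gen_mersenne k (s * k + r.+1) ^+ 2.
Proof.
move=> le_r2k; rewrite !gen_mersenne_block; try lia.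
have [-> ->] : (k - r = (k - r.+2).+2 /\ k - r.+1 = (k - r.+2).+1)%N by lia.
by rewrite !exprS; ring.
Qed.

Theorem theorem2p4 (n k a : nat)
    (hn : (2 <= n)%N) (hk : (2 <= k)%N) (ha : (a < k)%N) :
  gen_mersenne k (n * k + a) * gen_mersenne k (n * k + a - 2)
    - gen_mersenne k (n * k + a - 1) ^+ 2
  = if a == 1%N then - 2 ^+ (n - 1) * mersenne n ^+ (2 * k - 2) else 0.
Proof.
case: n hn => // m _; case: k hk ha => [|[|j]] // _.
case: a => [|[|r]] ha /=.
- (* The three indices are the last ones of block [m], endpoint included. *)
  have -> : (m.+1 * j.+2 + 0 = m * j.+2 + j.+2)%N by lia.
  have -> : (m * j.+2 + j.+2 - 2 = m * j.+2 + j)%N by lia.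
  have -> : (m * j.+2 + j.+2 - 1 = m * j.+2 + j.+1)%N by lia.
  by rewrite gen_mersenne_geometric // subrr.
- have -> : (m.+1 * j.+2 + 1 - 2 = m * j.+2 + j.+1)%N by lia.
  have -> : (m.+1 * j.+2 + 1 - 1 = m.+1 * j.+2 + 0)%N by lia.
  rewrite !gen_mersenne_block //.
  have -> : (m.+1 - 1 = m)%N by lia.
  have [-> ->] : (j.+2 - 1 = j.+1 /\ j.+2 - j.+1 = 1)%N by lia.
  have -> : (2 * j.+2 - 2 = j.+1 + j.+1)%N by lia.
  by rewrite -mersenne_cassini subn0 exprD !exprS; ring.
- have -> : (m.+1 * j.+2 + r.+2 - 2 = m.+1 * j.+2 + r)%N by lia.
  have -> : (m.+1 * j.+2 + r.+2 - 1 = m.+1 * j.+2 + r.+1)%N by lia.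
  by rewrite gen_mersenne_geometric ?subrr // ltnW.
Qed.
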